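(* Let $d\ge2$. If a countable group $G<\mathrm{Aut}(T_d)$ acts on $\partial T_d$ essentially freely and is self-replicating, then it is liftable.
   Context: Let $X=\{0,\dots,d-1\}$. $T_d$ is the rooted tree with vertex set $X^*$ ($v$ adjacent to $vx$). For $g\in\mathrm{Aut}(T_d)$ and $v\in X^*$ the section $g|_v\in\mathrm{Aut}(T_d)$ is defined by $g(vw)=g(v)\,g|_v(w)$ for all $w\in X^*$. Products are read left to right, $gh(y)=h(g(y))$. A subgroup $G<\mathrm{Aut}(T_d)$ is self-similar if it is closed under taking sections. $\mathrm{St}_G(v)$ is the stabilizer of the vertex $v$ and $\pi_v\colon\mathrm{St}_G(v)\to\mathrm{Aut}(T_d)$, $g\mapsto g|_v$, is a homomorphism. $G$ is self-replicating if it is self-similar, acts transitively on $X$, and $\pi_v(\mathrm{St}_G(v))=G$ for every $v\in X^*$. A self-similar group $G$ is liftable if there exist $i\in X$ and a homomorphism $\sigma\colon G\to\mathrm{St}_G(i)$ (the lifting) with $\pi_i\circ\sigma$ equal to the identity on $G$. The boundary $\partial T_d=X^{\infty}$ is the set of infinite words, with the uniform Bernoulli probability measure $\mu$ ($\mu(C_v)=d^{-n}$ for the set $C_v$ of infinite words starting with $v\in X^n$). A countable group $G<\mathrm{Aut}(T_d)$ acts essentially freely on $\partial T_d$ if the set of points with non-trivial stabilizer has $\mu$-measure $0$; equivalently, $\mu(\mathrm{Fix}(g))=0$ for all $g\in G$, $g\ne1$. *)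

(* Defs.v *)
From HB Require Import structures.
From mathcomp Require Import all_boot all_order all_algebra.
From mathcomp Require Import all_classical all_reals all_analysis.

Set Implicit Arguments.
Unset Strict Implicit.
Unset Printing Implicit Defensive.

Import Order.TTheory GRing.Theory Num.Theory.
Local Open Scope classical_set_scope.

(* Vertices of T_d are finite words over X = 'I_d; the root is [::]. *)
Notation vertex d := (seq 'I_d).

Section Trees.
Variable d : nat.
Implicit Types (x y : 'I_d) (u v w : vertex d).

Definition adjacent v w : Prop :=
  exists x, w = rcons v x \/ v = rcons w x.

Definition is_tree_aut (f : vertex d -> vertex d) : Prop :=
  [/\ bijective f, f [::] = [::] &
      forall v w, adjacent v w <-> adjacent (f v) (f w)].

Record treeAut := TreeAut {
  tree_fun :> vertex d -> vertex d;
  tree_funP : is_tree_aut tree_fun }.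

HB.instance Definition _ := gen_eqMixin treeAut.
HB.instance Definition _ := gen_choiceMixin treeAut.

Lemma treeAut_ext (g h : treeAut) : g =1 h -> g = h.
Proof.
case: g h => [f fP] [k kP] /= /funext fk; subst k.
by congr TreeAut; exact: Prop_irrelevance.
Qed.

Lemma id_tree_aut : is_tree_aut id.
Proof. by split=> //; exists id. Qed.

Lemma comp_tree_aut (g h : treeAut) : is_tree_aut (h \o g).
Proof.
case: g h => [g [gb g0 gE]] [h [hb h0 hE]]; split => /=.
- exact: bij_comp.
- by rewrite g0.
- by move=> v w; apply: iff_trans (gE v w) _; exact: hE.
Qed.

Lemma tree_aut_inv_exists (g : treeAut) :
  exists2 k : treeAut, cancel g k & cancel k g.
Proof.
case: g => [f [[k fK kK] f0 fE]].
have kP : is_tree_aut k.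
  split; first by exists f.
  - by rewrite -f0 fK.
  - by move=> v w; have := iff_sym (fE (k v) (k w)); rewrite !kK.
by exists (TreeAut kP).
Qed.

Definition treeAut1 : treeAut := TreeAut id_tree_aut.

(* Products are read left to right: (g * h) v = h (g v). *)
Definition treeAutM (g h : treeAut) : treeAut := TreeAut (comp_tree_aut g h).

Definition treeAutV (g : treeAut) : treeAut :=
  sval (cid2 (tree_aut_inv_exists g)).

Lemma treeAutVK (g : treeAut) : cancel g (treeAutV g).
Proof. by rewrite /treeAutV; case: cid2. Qed.

Lemma treeAutKV (g : treeAut) : cancel (treeAutV g) g.
Proof. by rewrite /treeAutV; case: cid2. Qed.

Fact treeAutMA : associative treeAutM.
Proof. by move=> g h k; exact: treeAut_ext. Qed.

Fact treeAut1M : left_id treeAut1 treeAutM.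
Proof. by move=> g; exact: treeAut_ext. Qed.

Fact treeAutM1 : right_id treeAut1 treeAutM.
Proof. by move=> g; exact: treeAut_ext. Qed.

Fact treeAutVM : left_inverse treeAut1 treeAutV treeAutM.
Proof. by move=> g; apply: treeAut_ext => v /=; rewrite treeAutKV. Qed.

Fact treeAutMV : right_inverse treeAut1 treeAutV treeAutM.
Proof. by move=> g; apply: treeAut_ext => v /=; rewrite treeAutVK. Qed.

HB.instance Definition _ := isGroup.Build treeAut
  treeAutMA treeAut1M treeAutM1 treeAutVM treeAutMV.

Lemma treeAutME (g h : treeAut) v : (g * h)%g v = h (g v).
Proof. by []. Qed.

Lemma treeAut_rcons (g : treeAut) v x : exists y, g (rcons v x) = rcons (g v) y.
Proof.
have [/bij_inj gI g0 gE] := tree_funP g.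
elim/last_ind: v x => [|v z IHv] x.
  have [|y [->|]] := (gE [::] [:: x]).1; first by exists x; left.
    by exists y; rewrite g0.
  by rewrite g0 => /(congr1 size); rewrite size_rcons.
have [|y [->|]] := (gE (rcons v z) (rcons (rcons v z) x)).1.
- by exists x; left.
- by exists y.
have [t ->] := IHv z => /rcons_inj[/gI /(congr1 size)].
by rewrite !size_rcons => /eqP; rewrite -[X in X == _]addn0 -addn2 eqn_add2l.
Qed.

Lemma size_treeAut (g : treeAut) v : size (g v) = size v.
Proof.
have [_ g0 _] := tree_funP g.
elim/last_ind: v => [|v x IHv]; first by rewrite g0.
by have [y ->] := treeAut_rcons g v x; rewrite !size_rcons IHv.
Qed.

Lemma treeAut_take (g : treeAut) v w : take (size v) (g (v ++ w)) = g v.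
Proof.
elim/last_ind: w => [|w x IHw].
  by rewrite cats0 take_oversize// size_treeAut.
rewrite -rcons_cat; have [y ->] := treeAut_rcons g (v ++ w) x.
by rewrite -cats1 takel_cat ?IHw// size_treeAut size_cat leq_addr.
Qed.

Definition section_fun (g : treeAut) v w : vertex d :=
  drop (size v) (g (v ++ w)).

Lemma section_funE (g : treeAut) v w : g (v ++ w) = g v ++ section_fun g v w.
Proof. by rewrite -[LHS](cat_take_drop (size v)) treeAut_take. Qed.

Lemma adjacent_cat u v w : adjacent (u ++ v) (u ++ w) <-> adjacent v w.
Proof.
have catI a b : u ++ a = u ++ b -> a = b.
  by move/eqP; rewrite eqseq_cat// eqxx => /eqP.
split=> -[x [] e]; exists x; [left|right|left|right].
- by apply: catI; rewrite e rcons_cat.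
- by apply: catI; rewrite e rcons_cat.
- by rewrite e rcons_cat.
- by rewrite e rcons_cat.
Qed.

Lemma section_funK (g h : treeAut) v : cancel g h ->
  cancel (section_fun g v) (section_fun h (g v)).
Proof.
move=> gK w; rewrite /section_fun -section_funE gK size_treeAut.
by rewrite drop_size_cat.
Qed.

Lemma section_tree_aut (g : treeAut) v : is_tree_aut (section_fun g v).
Proof.
split.
- have [k gk kg] := tree_aut_inv_exists g.
  exists (section_fun k (g v)); first exact: section_funK gk.
  by have := section_funK (g v) kg; rewrite gk.
- by rewrite /section_fun cats0 drop_oversize// size_treeAut.
- move=> a b; have [_ _ gE] := tree_funP g.
  have := iff_trans (iff_sym (adjacent_cat v a b)) (gE _ _).
  rewrite !section_funE => h; exact: iff_trans h (adjacent_cat _ _ _).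
Qed.

(* The section g|_v, characterised by sectionE. *)
Definition section (g : treeAut) v : treeAut := TreeAut (section_tree_aut g v).

Lemma sectionE (g : treeAut) v w : g (v ++ w) = g v ++ section g v w.
Proof. exact: section_funE. Qed.

Implicit Types (G : set treeAut) (g : treeAut).

Definition subgroup G : Prop := group_closed [in G].

Definition stabilizer G v : set treeAut := [set g | G g /\ g v = v].

Definition self_similar G : Prop := forall g v, G g -> G (section g v).

Definition self_replicating G : Prop :=
  [/\ self_similar G,
      forall x y, exists2 g, G g & g [:: x] = [:: y] &
      forall v, (fun g => section g v) @` stabilizer G v = G].

(* sigma is a homomorphism G -> St_G(i); its values outside G are irrelevant. *)
Definition liftable G : Prop :=
  self_similar G /\
  exists (i : 'I_d) (sigma : treeAut -> treeAut),
    [/\ {in G, forall g, sigma g \in stabilizer G [:: i]},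
        {in G &, {morph sigma : g h / (g * h)%g}} &
        {in G, forall g, section (sigma g) [:: i] = g}].

(* The action on X^oo: the n-th letter of g(x) is read off g(x_0 ... x_n);
   the default value of nth is never used, cf. boundary_actE. *)
Definition boundary_act g (x : nat -> 'I_d) : nat -> 'I_d :=
  fun n => nth (x n) (g (mkseq x n.+1)) n.

Lemma boundary_actE g (x : nat -> 'I_d) n :
  mkseq (boundary_act g x) n = g (mkseq x n).
Proof.
apply/esym; case: n => [|n]; first by case: (tree_funP g).
apply: (@eq_from_nth _ (x 0)) => [|k]; first by rewrite size_treeAut !size_mkseq.
rewrite size_treeAut size_mkseq => kn; rewrite nth_mkseq// /boundary_act.
have -> : mkseq x n.+1 = mkseq x k.+1 ++ drop k.+1 (mkseq x n.+1).
  rewrite -[LHS](cat_take_drop k.+1); congr (_ ++ _).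
  by rewrite /mkseq -map_take take_iota (minn_idPl kn).
rewrite sectionE nth_cat size_treeAut size_mkseq ltnSn.
by apply: set_nth_default; rewrite size_treeAut size_mkseq.
Qed.

End Trees.

(* Measurable spaces are pointed in MathComp-Analysis, whence the argument
   1 < d of the type of infinite words. *)
Definition infinite_word (d : nat) (d_gt1 : 1 < d) : Type := nat -> 'I_d.

HB.instance Definition _ (d : nat) (d_gt1 : 1 < d) :=
  Choice.copy (infinite_word d_gt1) (nat -> 'I_d).
HB.instance Definition _ (d : nat) (d_gt1 : 1 < d) :=
  isPointed.Build (infinite_word d_gt1) (fun=> Ordinal (ltnW d_gt1)).

Definition cylinder (d : nat) (d_gt1 : 1 < d) (v : vertex d) :
    set (infinite_word d_gt1) :=
  [set x | mkseq x (size v) = v].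
Arguments cylinder {d} d_gt1 v.

(* X^oo with the sigma-algebra generated by the cylinders, which is the Borel
   sigma-algebra of the product topology. *)
Definition boundary (d : nat) (d_gt1 : 1 < d) :=
  g_sigma_algebraType (range (cylinder d_gt1)).

HB.instance Definition _ (d : nat) (d_gt1 : 1 < d) :=
  Measurable.on (boundary d_gt1).

(* The cylinders together with set0 form a pi-system, so there is at most one
   such probability measure; it exists by uniform_bernoulli_exists. *)
Definition uniform_bernoulli (R : realType) (d : nat) (d_gt1 : 1 < d)
    (mu : probability (boundary d_gt1) R) : Prop :=
  forall v : vertex d, mu (cylinder d_gt1 v) = ((d%:R ^- size v)%R)%:E.

Definition essentially_free (R : realType) (d : nat) (d_gt1 : 1 < d)
    (mu : probability (boundary d_gt1) R) (G : set (treeAut d)) : Prop :=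
  mu.-negligible
    [set x | exists g, [/\ G g, g <> 1%g & boundary_act g x = x]].

Section Existence.
Variables (R : realType) (d : nat) (d_gt1 : 1 < d).
Local Open Scope ring_scope.

(* Fair random digits in base d are the base-d digits of a uniformly
   distributed point of [0, 1[. *)
Definition digit (n : nat) (t : R) : 'I_d :=
  Ordinal (ltn_pmod (Num.truncn (t * d%:R ^+ n.+1)) (ltnW d_gt1)).

Definition I01 : set R := `[0, 1[%classic.

Definition digits (t : measurableTypeR R) : boundary d_gt1 :=
  fun n => digit n (if t \in I01 then t else 0).

Let wval (v : vertex d) : nat := foldl (fun k (x : 'I_d) => k * d + x)%N 0%N v.

Let wval_rcons v x : wval (rcons v x) = (wval v * d + x)%N.
Proof. by rewrite /wval -cats1 foldl_cat. Qed.

Let d_gt0 : 0 < d%:R :> R.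
Proof. by rewrite ltr0n ltnW. Qed.

Let truncn_divd (t : R) n : 0 <= t ->
  (Num.truncn (t * d%:R ^+ n.+1) %/ d)%N = Num.truncn (t * d%:R ^+ n).
Proof.
move=> t0; have d0 : (0 < d)%N by exact: ltnW.
have pos k : 0 <= t * d%:R ^+ k by rewrite mulr_ge0// exprn_ge0// ltW.
apply/eqP; rewrite eq_sym truncn_eq//; apply/andP; split.
  rewrite -(ler_pM2r d_gt0) -natrM -mulrA -exprSr -truncn_ge_nat//.
  exact: leq_divM.
rewrite -(ltr_pM2r d_gt0) -natrM -mulrA -exprSr -truncn_lt_nat//.
by rewrite -ltn_divLR.
Qed.

Let mkseq_digit (t : R) v : 0 <= t < 1 ->
  (mkseq (digit^~ t) (size v) = v) <->
  (Num.truncn (t * d%:R ^+ size v) = wval v).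
Proof.
move=> /andP[t0 t1]; elim/last_ind: v => [|v x IHv].
  split=> // _; rewrite /wval /= expr0 mulr1.
  by apply/eqP; rewrite truncn_eq// t0 t1.
rewrite size_rcons mkseqS wval_rcons; split.
  move=> /rcons_inj[/IHv vE <-] /=.
  by rewrite -vE -(truncn_divd (size v))// -divn_eq.
move=> vE; have xv : Num.truncn (t * d%:R ^+ size v) = wval v.
  by rewrite -(truncn_divd (size v))// vE divnMDl ?divn_small ?addn0// ltnW.
rewrite (IHv.2 xv); congr rcons; apply: val_inj => /=.
by rewrite vE modnMDl modn_small.
Qed.

Let Icyl v : set R :=
  `[(wval v)%:R / d%:R ^+ size v, (wval v).+1%:R / d%:R ^+ size v[%classic.

Let digits_Icyl v (t : R) : t \in I01 ->
  (cylinder d_gt1 v (digits t)) <-> Icyl v t.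
Proof.
move=> tI; have := tI; rewrite inE /I01/= in_itv/= => t01.
rewrite /cylinder/= /digits tI /Icyl/= in_itv/=.
apply: iff_trans (mkseq_digit v t01) _.
have dn0 : 0 < d%:R ^+ size v :> R by rewrite exprn_gt0.
have /andP[t0 _] := t01.
rewrite ler_pdivrMr// ltr_pdivlMr//.
by split=> [/eqP|h]; [|apply/eqP]; rewrite truncn_eq// mulr_ge0// ltW.
Qed.

Let wval_lt v : (wval v < d ^ size v)%N.
Proof.
elim/last_ind: v => [//|v x IHv]; rewrite wval_rcons size_rcons expnSr.
apply: (@leq_trans ((wval v).+1 * d)%N); first by rewrite mulSn addnC ltn_add2r.
by rewrite leq_mul2r IHv orbT.
Qed.

Let Icyl_sub v : Icyl v `<=` I01.
Proof.
move=> t; rewrite /Icyl /I01/= !in_itv/= => /andP[t0 t1].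
have dn0 : 0 < d%:R ^+ size v :> R by rewrite exprn_gt0.
rewrite (le_trans _ t0) ?divr_ge0 ?ler0n// ?(ltW dn0)//=.
by rewrite (lt_le_trans t1)// ler_pdivrMr// mul1r -natrX ler_nat wval_lt.
Qed.

Let preimage_digits v : digits @^-1` cylinder d_gt1 v `&` I01 = Icyl v.
Proof.
apply/seteqP; split=> t /=.
  by case=> vt /mem_set tI; apply/digits_Icyl.
move=> vt; have tI := Icyl_sub vt; split=> //.
by apply/digits_Icyl => //; exact: mem_set.
Qed.

Lemma measurable_I01 : measurable (I01 : set (measurableTypeR R)).
Proof. exact: measurable_itv. Qed.

Lemma measurable_digits : measurable_fun setT digits.
Proof.
apply: (@measurability _ _ _ (boundary d_gt1) setT digits
  (range (cylinder d_gt1))) => //.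
move=> _ [_ [v _ <-] <-]; rewrite setTI.
have -> : digits @^-1` cylinder d_gt1 v =
    (digits @^-1` cylinder d_gt1 v `&` I01) `|`
    (digits @^-1` cylinder d_gt1 v `&` ~` I01).
  by rewrite -setIUr setUv setIT.
rewrite preimage_digits; apply: measurableU; first exact: measurable_itv.
have E t : (~` I01) t -> digits t = digits 1.
  move=> tN; have tI := memNset tN; have I1 : 1 \notin I01.
    by rewrite notin_setE /I01/= in_itv/= ltxx andbF.
  by rewrite /digits (negbTE I1) tI.
have [v1|v1] := pselect (cylinder d_gt1 v (digits 1)).
  rewrite (_ : _ `&` _ = ~` I01); first exact: measurableC measurable_I01.
  by apply/seteqP; split=> [t []//|t tI]; split=> //=; rewrite E.
rewrite (_ : _ `&` _ = set0)//; apply/seteqP; split=> // t [/= + tI].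
by rewrite E.
Qed.

HB.instance Definition _ :=
  isMeasurableFun.Build _ _ _ _ digits measurable_digits.

Definition unif01 : set (measurableTypeR R) -> \bar R :=
  mrestr (@lebesgue_measure R) measurable_I01.

HB.instance Definition _ := Measure.on unif01.

Lemma unif01_setT : unif01 setT = 1%E.
Proof.
by rewrite /unif01 /mrestr setTI lebesgue_measure_itv/= lte01 oppr0 adde0.
Qed.

HB.instance Definition _ := Measure_isProbability.Build _ _ _ unif01 unif01_setT.

Lemma uniform_bernoulli_exists :
  exists mu : probability (boundary d_gt1) R, uniform_bernoulli mu.
Proof.
exists (distribution unif01 digits) => v.
rewrite [LHS](_ : _ = lebesgue_measure (Icyl v)); last first.
  by rewrite -preimage_digits.
have dn0 : 0 < d%:R ^+ size v :> R by rewrite exprn_gt0.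
rewrite lebesgue_measure_itv/= lte_fin ltr_pM2r ?invr_gt0// ltr_nat ltnSn.
by rewrite -EFinB -mulrBl -natrB// subSnn mul1r.
Qed.

End Existence.

(* Main.v *)
Require Import Defs.
From mathcomp Require Import all_boot all_order all_algebra.
From mathcomp Require Import all_classical all_reals all_analysis.

(** Essential freeness makes the section homomorphism at a vertex [v] injective
    on the stabilizer of [v]: a non-trivial element of its kernel would fix the
    cylinder of [v], of positive measure, pointwise.  Self-replication makes it
    surjective, and its inverse, for [v] of length one, is the lifting. *)

Set Implicit Arguments.
Unset Strict Implicit.
Unset Printing Implicit Defensive.

Import Order.TTheory GRing.Theory Num.Theory.
Local Open Scope classical_set_scope.

(** Expand both sides on [v ++ w] and cancel the common prefix [h (g v)]. On the stabilizer of [v]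
    this makes taking sections at [v] a homomorphism. *)
Lemma sectionM (d : nat) (g h : treeAut d) (v : vertex d) :
  section (g * h)%g v = (section g v * section h (g v))%g.
Proof.
apply: treeAut_ext => w.
have : h (g (v ++ w)) = h (g v) ++ section (g * h)%g v w.
  exact: (sectionE (g * h)%g).
by rewrite !sectionE => /eqP; rewrite eqseq_cat// eqxx => /eqP.
Qed.

Lemma section1 (d : nat) (v : vertex d) : section 1%g v = 1%g :> treeAut d.
Proof. by apply: treeAut_ext => w /=; rewrite /section_fun/= drop_size_cat. Qed.

Lemma boundary_act_section1 (d : nat) (d_gt1 : (1 < d)%N) (g : treeAut d)
    (v : vertex d) (x : infinite_word d_gt1) :
  g v = v -> section g v = 1%g -> cylinder d_gt1 v x -> boundary_act g x = x.
Proof.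
move=> gv gv1 xv; have fix_ext w : g (v ++ w) = v ++ w.
  by rewrite sectionE gv gv1.
(* A prefix of length [m] both begins with [v] and contains the letter of index [n]. *)
apply/funext => n; pose m := (n.+1 + size v)%N.
have gm : g (mkseq x m) = mkseq x m.
  suff -> : mkseq x m = v ++ drop (size v) (mkseq x m) by rewrite fix_ext.
  rewrite -{1}(cat_take_drop (size v) (mkseq x m)) -{3}xv.
  by rewrite /mkseq -map_take take_iota (minn_idPl (leq_addl _ _)).
have nm : (n < m)%N by rewrite /m addSn ltnS leq_addr.
have := congr1 (fun s => nth (x n) s n) (boundary_actE g x m).
by rewrite gm !nth_mkseq.
Qed.

Lemma essentially_free_section1 (R : realType) (d : nat) (d_gt1 : (1 < d)%N)
    (mu : probability (boundary d_gt1) R) (G : set (treeAut d))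
    (g : treeAut d) (v : vertex d) :
  uniform_bernoulli mu -> essentially_free mu G ->
  stabilizer G v g -> section g v = 1%g -> g = 1%g.
Proof.
move=> mu_unif [A [mA A0 fixA]] [Gg gv] gv1; apply: contrapT => g1.
(* If [g] were non-trivial, the null set [A] would contain a cylinder of positive measure. *)
have cylA : cylinder d_gt1 v `<=` A.
  move=> x xv; apply: fixA; exists g; split=> //.
  exact: boundary_act_section1 xv.
have mC : measurable (cylinder d_gt1 v : set (boundary d_gt1)).
  by apply: sub_sigma_algebra; exists v.
have : (mu (cylinder d_gt1 v) <= mu A)%E by apply: le_measure; rewrite ?inE.
rewrite mu_unif A0 lee_fin leNgt => /negP; apply.
by rewrite invr_gt0 exprn_gt0// ltr0n ltnW.
Qed.

Lemma essentially_free_section_inj (R : realType) (d : nat) (d_gt1 : (1 < d)%N)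
    (mu : probability (boundary d_gt1) R) (G : set (treeAut d)) (v : vertex d) :
  uniform_bernoulli mu -> subgroup G -> essentially_free mu G ->
  {in stabilizer G v &, injective (fun g => section g v)}.
Proof.
move=> mu_unif [G1 GM] free g h /set_mem[Gg gv] /set_mem[Gh hv] /= gh.
have hVv : (h^-1)%g v = v by rewrite -{1}hv; exact: treeAutVK.
suff /(congr1 (fun k => k * h)%g) : (g * h^-1)%g = 1%g.
  by rewrite mulgVK mul1g.
apply: (essentially_free_section1 mu_unif free (v := v)).
  split; last by rewrite treeAutME gv.
  by apply: set_mem; apply: GM; exact: mem_set.
(* Writing the second base vertex as [h v] lets the product rule fold both sections into that of
   [h * h^-1]. *)
by rewrite sectionM gv gh -{2}hv -sectionM mulgV section1.
Qed.

Theorem proposition5p1 (R : realType) (d : nat) (d_gt1 : (1 < d)%N)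
    (mu : probability (boundary d_gt1) R) (mu_unif : uniform_bernoulli mu)
    (G : set (treeAut d)) :
  subgroup G -> countable G ->
  essentially_free mu G -> self_replicating G -> liftable G.
Proof.
move=> Gsub _ free [ssG _ onto]; split=> //.
pose i : 'I_d := Ordinal (ltnW d_gt1); exists i.
pose lifts g h := stabilizer G [:: i] h /\ section h [:: i] = g.
(* The default [1] is harmless: every element of [G] has a lift, by surjectivity of the section
   map. *)
pose sigma g := xget 1%g (lifts g).
have sigmaP g : G g -> lifts g (sigma g).
  move=> Gg; apply: (@xgetPex _ 1%g).
  by move: Gg; rewrite -(onto [:: i]) => -[h hst hg]; exists h.
exists sigma; split.
- by move=> g /set_mem/sigmaP[+ _] => /mem_set.
- move=> g h /set_mem Gg /set_mem Gh.
  have GM a b : G a -> G b -> G (a * b)%g.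
    by move=> /mem_set Ga /mem_set Gb; exact/set_mem/(group_closedM Gsub).
  have [gst gs] := sigmaP _ Gg; have [hst hs] := sigmaP _ Gh.
  have [ghst ghs] := sigmaP _ (GM _ _ Gg Gh).
  (* Both [sigma (g * h)] and [sigma g * sigma h] stabilize [[:: i]] with section [g * h] there, so
     injectivity identifies them. *)
  apply: (essentially_free_section_inj mu_unif Gsub free (v := [:: i])).
  + exact: mem_set.
  + apply: mem_set; move: gst hst => [Gsg sgi] [Gsh shi].
    by split; [exact: GM | rewrite treeAutME sgi].
  + by rewrite ghs sectionM gst.2 gs hs.
- by move=> g /set_mem/sigmaP[].
Qed.
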